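(* For every connected graph $G$ on $n$ vertices, $b(G)\leq (1+o(1))\sqrt{n}$, where $o(1)$ denotes a quantity depending only on $n$ that tends to $0$ as $n\to\infty$. Equivalently: for every $\varepsilon>0$ there exists $N$ such that every connected graph $G$ on $n\geq N$ vertices satisfies $b(G)\leq (1+\varepsilon)\sqrt n$.
   Context: All graphs are finite. For a graph $G$ with graph distance $d_G$, the burning number $b(G)$ is the smallest integer $k$ such that there exist vertices $x_0,x_1,\dots,x_{k-1}$ of $G$ (not necessarily distinct) with the property that every vertex $u$ of $G$ satisfies $d_G(u,x_i)\leq i$ for some $i\in\{0,\dots,k-1\}$; i.e. $V(G)$ can be covered by closed balls of radii $0,1,\dots,k-1$. (Equivalently, it is the minimum number of rounds needed to burn all of $G$ when in each round a new fire is started at one vertex and all existing fires spread to all neighbouring vertices.) *)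

(* Defs.v *)
From mathcomp Require Import all_boot.

Set Implicit Arguments.
Unset Strict Implicit.
Unset Printing Implicit Defensive.

Record sgraph := SGraph {
  vertex :> finType;
  adj : rel vertex;
  adj_sym : symmetric adj;
  adj_irr : irreflexive adj }.

Definition connected (G : sgraph) : Prop :=
  forall u v : G, connect (@adj G) u v.

Definition walk (G : sgraph) (u v : G) (r : nat) : bool :=
  [exists p : r.-tuple G, path (@adj G) u p && (last u p == v)].

(* The least length of a walk from u to v. Distances in a component are less
   than #|G|, so for u and v in different components the value is #|G|, which
   exceeds every finite distance and stands for infinity. *)
Definition dist (G : sgraph) (u v : G) : nat :=
  find (walk u v) (iota 0 #|G|).

Definition coverable (G : sgraph) (k : nat) : bool :=
  [exists x : {ffun 'I_k -> G}, [forall u : G, [exists i : 'I_k,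
     dist u (x i) <= i]]].

Lemma dist_minP (G : sgraph) (u v : G) :
  connect (@adj G) u v ->
  walk u v (dist u v) /\ forall r, walk u v r -> dist u v <= r.
Proof.
move=> /connectP[p0 hp0 ->]; have [p hp up _] := shortenP hp0.
have sp : size p < #|G|.
  by have := max_card (mem (u :: p)); have /card_uniqP -> := up.
have wp : walk u (last u p) (size p).
  by apply/existsP; exists (in_tuple p); rewrite hp /=.
have hs : has (walk u (last u p)) (iota 0 #|G|).
  by apply/hasP; exists (size p); rewrite ?mem_iota.
have lt : dist u (last u p) < #|G| by move: hs; rewrite has_find size_iota.
split; first by have := nth_find 0 hs; rewrite nth_iota.
move=> r wr; rewrite leqNgt; apply/negP => rlt.
by have := before_find 0 rlt; rewrite nth_iota ?(ltn_trans rlt) // add0n wr.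
Qed.

Lemma dist_infty (G : sgraph) (u v : G) :
  ~~ connect (@adj G) u v -> dist u v = #|G|.
Proof.
move=> nc; rewrite /dist hasNfind ?size_iota //; apply/hasPn => r _.
apply: contra nc => /existsP[p /andP[hp /eqP <-]].
by apply/connectP; exists p.
Qed.

Lemma dist_refl (G : sgraph) (u : G) : dist u u = 0.
Proof.
apply/eqP; rewrite -leqn0; apply: (dist_minP (connect0 _ u)).2.
by apply/existsP; exists [tuple]; rewrite /= eqxx.
Qed.

Lemma coverable_exists (G : sgraph) : exists k, coverable G k.
Proof.
exists #|G|; apply/existsP; exists [ffun i => enum_val i].
apply/forallP => u; apply/existsP; exists (enum_rank u).
by rewrite ffunE enum_rankK dist_refl.
Qed.

Definition burning_number (G : sgraph) : nat := ex_minn (coverable_exists G).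

(* Main.v *)
(** Work in a breadth-first spanning tree and give every radius r a price c r.
    Tile the root path of a deepest vertex by intervals of 2R vertices, each
    covered by a ball of radius R around its middle, with a uniformly random
    phase. Seen from a branch that leaves this path, the distance to the nearest
    tile boundary, which is the depth up to which the branch is already covered,
    is then uniform on {0, ..., R-1}. By induction on the branches, a tree part
    X below v with the depths up to a uniform n < R already covered has a cover
    of mean price at most W |X| / R, as soon as the prices satisfy the
    inequalities of [hang_coverable].

    Round radii up to multiples qd, with q <= D; there are d balls in each class
    q. Cut the tree into boundedly many connected parts and cover them one after
    the other, the price of a class being its current excess use plus theta. The
    sum of the squared excesses then grows only by second-order terms, so no
    class overruns its d balls once (Dd)^2 exceeds n by a constant factor. Each
    part also uses one ball of radius Dd, and these are boundedly many extra
    balls in total. *)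
Require Import Defs.
From mathcomp Require Import all_boot all_order all_algebra.
From mathcomp Require Import reals.
From mathcomp Require Import zify ring lra.
Import Order.TTheory GRing.Theory Num.Theory.
Local Open Scope ring_scope.
Set Implicit Arguments.
Unset Strict Implicit.
Unset Printing Implicit Defensive.

(** * Finite sums over phases and residues *)

Lemma sum_subn_shift (V : zmodType) (g : nat -> V) (m C : nat) :
  \sum_(b < m) g (C.+1 - b)%N =
  \sum_(b < m) g (C - b)%N + g C.+1 - g (C.+1 - m)%N.
Proof.
case: m => [|m]; first by rewrite !big_ord0 subn0 add0r subrr.
rewrite big_ord_recl [in RHS]big_ord_recr /= subn0 subSS.
under eq_bigr => b _ do rewrite /bump /= add1n subSS.
by rewrite addrAC addrK addrC.
Qed.

(** Any [m] consecutive integers meet each residue once, so a uniform phase makes offsets within a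
    tile uniform. *)
Lemma sum_subn_modn (V : zmodType) (f : nat -> V) (m C : nat) :
  (0 < m <= C.+1)%N ->
  \sum_(b < m) f ((C - b) %% m)%N = \sum_(b < m) f b.
Proof.
move=> /andP[m0 mC].
have -> : C = (m.-1 + (C.+1 - m))%N by lia.
elim: (C.+1 - m)%N => [|t IH].
  rewrite addn0 (reindex_inj rev_ord_inj); apply: eq_bigr => i _ /=.
  by congr f; rewrite modn_small; have := ltn_ord i; lia.
rewrite addnS (sum_subn_shift (fun x => f (x %% m)%N)) IH /=.
have -> : ((m.-1 + t).+1 = t + m)%N by lia.
by rewrite addnK modnDr addrK.
Qed.

(** Hermite's identity; it gives the total number of full tiles over all phases. *)
Lemma sum_subn_divn (F : realFieldType) (m C : nat) :
  (0 < m <= C.+1)%N ->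
  \sum_(b < m) (((C - b) %/ m)%N%:R : F) = (C.+1 - m)%N%:R.
Proof.
move=> /andP[m0 mC].
have -> : C = (m.-1 + (C.+1 - m))%N by lia.
elim: (C.+1 - m)%N => [|t IH].
  rewrite addn0 (_ : (_ - m)%N = 0%N); last by lia.
  by rewrite big1 // => i _; rewrite divn_small //; lia.
rewrite addnS (sum_subn_shift (fun x => (x %/ m)%N%:R)) IH /=.
have -> : ((m.-1 + t).+1 = t + m)%N by lia.
rewrite addnK divnDr ?dvdnn // divnn m0 natrD.
rewrite (_ : ((t + m).+1 - m = t + 1)%N); last by lia.
rewrite natrD (_ : true%:R = 1 :> F) //; ring.
Qed.

(** The distance to the nearer end of a tile is a two-to-one function of the offset, hence
    uniform. *)
Lemma sum_reflect (V : zmodType) (f : nat -> V) (R : nat) :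
  \sum_(i < R + R) f (minn i (R + R - 1 - i)) = (\sum_(i < R) f i) *+ 2.
Proof.
rewrite big_split_ord /= mulr2n; congr (_ + _).
  by apply: eq_bigr => i _; congr f; have := ltn_ord i; lia.
rewrite (reindex_inj rev_ord_inj); apply: eq_bigr => i _; congr f => /=.
by have := ltn_ord i; lia.
Qed.

Lemma sum_pairs (V : nmodType) (f : nat -> V) (R : nat) :
  \sum_(i < R + R) f i = \sum_(i < R) (f i.*2 + f i.*2.+1).
Proof.
elim: R => [|R IH]; first by rewrite !big_ord0.
by rewrite addSn addnS !big_ord_recr /= IH addrA addnn.
Qed.

Lemma sum_half (V : nmodType) (f : nat -> V) (R : nat) :
  \sum_(i < R + R) f i./2 = (\sum_(i < R) f i) *+ 2.
Proof.
rewrite (sum_pairs (fun i => f i./2)) -sumrMnl; apply: eq_bigr => i _.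
by rewrite /= doubleK uphalf_double mulr2n.
Qed.

Lemma sum_subn (V : zmodType) (f : nat -> V) (j R : nat) :
  \sum_(n < R) (if (j <= n)%N then f (n - j)%N else 0) = \sum_(k < R - j) f k.
Proof.
elim: R => [|R IH]; first by rewrite sub0n !big_ord0.
rewrite big_ord_recr /= IH; case: leqP => jR.
  by rewrite subSn // big_ord_recr.
by rewrite addr0 (_ : R.+1 - j = R - j)%N //; lia.
Qed.

Lemma ler_sum_ord (F : realFieldType) (f : nat -> F) (m n : nat) :
  (forall i, 0 <= f i) -> (m <= n)%N -> \sum_(i < m) f i <= \sum_(i < n) f i.
Proof.
move=> f0 mn; rewrite (big_ord_widen n f mn) big_mkcond ler_sum // => i _.
by case: ifP.
Qed.

Lemma mean_prefix_le (F : realFieldType) (f : nat -> F) (h n : nat) :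
  (forall i j, (i <= j < n)%N -> f i <= f j) -> (h <= n)%N ->
  n%:R * \sum_(i < h) f i <= h%:R * \sum_(i < n) f i.
Proof.
move=> f_mono; rewrite leq_eqVlt => /orP[/eqP->//|hn].
have -> : \sum_(i < n) f i = \sum_(i < h) f i + \sum_(i < n - h) f (h + i)%N.
  by rewrite -[n in LHS](subnKC (ltnW hn)) big_split_ord.
rewrite mulrDr.
have -> : n%:R = h%:R + (n - h)%:R :> F by rewrite -natrD subnKC // ltnW.
rewrite mulrDl lerD2l.
have lo : \sum_(i < h) f i <= h%:R * f h.
  rewrite mulr_natl -[X in _ *+ X]card_ord -sumr_const ler_sum // => i _.
  by apply: f_mono; have := ltn_ord i; lia.
have hi : (n - h)%:R * f h <= \sum_(i < n - h) f (h + i)%N.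
  rewrite mulr_natl -[X in _ *+ X]card_ord -sumr_const ler_sum // => i _.
  by apply: f_mono; have := ltn_ord i; lia.
apply: (@le_trans _ _ ((n - h)%:R * (h%:R * f h))).
  by rewrite ler_wpM2l.
by rewrite mulrCA ler_wpM2l.
Qed.

(** Used with [z] the signed overrun of a class, [y] its positive part, [x] the newly used balls and
    [t] the new allowance. Clipping at zero only helps, and [x] and [t] differ by at most [k]. *)
Lemma max_sqr_le (F : realFieldType) (x y z t k : F) :
  0 <= x <= k -> 0 <= t <= k -> 0 <= y -> z <= y ->
  Num.max 0 (z + (x - t)) ^+ 2 <= y ^+ 2 + (y * (x - t)) *+ 2 + k ^+ 2.
Proof.
move=> /andP[x0 xk] /andP[t0 tk] y0 zy.
have xt : (x - t) ^+ 2 <= k ^+ 2.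
  rewrite -real_normK ?num_real // ler_pXn2r ?nnegrE ?normr_ge0 //; last by lra.
  by rewrite ler_norml; lra.
have le : Num.max 0 (z + (x - t)) ^+ 2 <= (y + (x - t)) ^+ 2.
  case: (lerP 0 (z + (x - t))) => h; last by rewrite expr0n sqr_ge0.
  by rewrite ler_pXn2r ?nnegrE //; lra.
by apply: le_trans le _; rewrite mulr2n; lra.
Qed.

(** * Rooted forests given by a parent map and depths *)

Section Forest.
Variables (T : finType) (par : T -> T) (dep : T -> nat).
Hypothesis dep_par : forall u, dep (par u) = (dep u).-1.

Definition near (u w : T) (r : nat) : Prop :=
  exists a b : nat, (a + b <= r)%N /\ iter a par u = iter b par w.

Definition covered (L : seq (T * nat)) (u : T) : Prop :=
  exists2 b, b \in L & near u b.1 b.2.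

Definition hang (v : T) (X : {set T}) : Prop :=
  forall u, u \in X -> (dep v < dep u)%N /\ (par u = v \/ par u \in X).

Lemma nearxx (u : T) (r : nat) : near u u r.
Proof. by exists 0%N, 0%N. Qed.

Lemma near_le (u w : T) (r s : nat) : (r <= s)%N -> near u w r -> near u w s.
Proof. by move=> rs [a [b [ab e]]]; exists a, b; split => //; lia. Qed.

Lemma dep_iter (k : nat) (u : T) : dep (iter k par u) = (dep u - k)%N.
Proof. by elim: k => [|k IH]; rewrite ?subn0 //= dep_par IH subnS. Qed.

Lemma hang_iter (v : T) (X : {set T}) (u : T) (k : nat) :
  hang v X -> u \in X -> (k < dep u - dep v)%N -> iter k par u \in X.
Proof.
move=> hX uX; elim: k => // k IH kd.
have /hX [d [e|//]] := IH (ltnW kd).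
by move: (dep_iter k.+1 u); rewrite /= e; lia.
Qed.

Lemma hang_top (v : T) (X : {set T}) (u : T) :
  hang v X -> u \in X -> iter (dep u - dep v) par u = v.
Proof.
move=> hX uX; have [d _] := hX _ uX.
have e : (dep u - dep v = (dep u - dep v).-1.+1)%N by lia.
have k : ((dep u - dep v).-1 < dep u - dep v)%N by lia.
have /hX [d' [//|]] := hang_iter hX uX k; rewrite e //=.
by move=> /hX []; rewrite dep_par dep_iter; lia.
Qed.

(** [br w] is the spine position at which the path upwards from [w] meets the spine; the strict
    inequality drops the spine vertex itself. *)
Definition branch (v : T) (X : {set T}) (H : nat) (br : T -> 'I_H.+1)
    (j : nat) : {set T} :=
  [set w in X | (br w == j :> nat) && (j < dep w - dep v)%N].

(** Each vertex is assigned to its deepest ancestor, possibly itself, on the path from [v] to [u].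
    Outside the branches only the spine without [v] remains, hence the summand [H]. *)
Lemma spine_decomposition (v u : T) (X : {set T}) (H := (dep u - dep v)%N)
    (s := fun j => iter (H - j) par u) :
  hang v X -> u \in X -> (forall w, w \in X -> dep w <= dep u)%N ->
  exists br : T -> 'I_H.+1,
  [/\ forall w, w \in X ->
        (br w <= dep w - dep v)%N /\
        iter (dep w - dep v - br w) par w = s (br w),
      forall j, (j <= H)%N -> hang (s j) (branch v X br j) &
      (\sum_(j < H.+1) #|branch v X br j| + H = #|X|)%N].
Proof.
move=> hX uX umax.
have [duv _] := hX _ uX.
have H0 : (0 < H)%N by rewrite /H; lia.
have s0 : s 0%N = v by rewrite /s subn0; exact: hang_top hX uX.
have ds j : (j <= H)%N -> (dep (s j) = dep v + j)%N.
  by move=> jH; rewrite /s dep_iter /H; move: jH; rewrite /H; lia.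
have sX j : (0 < j <= H)%N -> s j \in X.
  by move=> jH; apply: (hang_iter hX uX); rewrite /H in jH *; lia.
pose e w := (dep w - dep v)%N.
pose P w (j : 'I_H.+1) := (j <= e w)%N && (iter (e w - j) par w == s j).
have P0 w : w \in X -> P w ord0.
  by move=> wX; rewrite /P /= subn0 s0 (hang_top hX wX) eqxx.
pose br w := [arg max_(j > ord0 | P w j) (j : nat)]%N.
have brP w : w \in X ->
    P w (br w) /\ forall j : 'I_H.+1, P w j -> (j <= br w)%N.
  by move=> wX; rewrite /br; case: arg_maxnP => [|i Pi mi]; rewrite ?P0.
have br_s j : (0 < j <= H)%N -> br (s j) = j :> nat.
  move=> jH; have [/andP[le _] mx] := brP _ (sX _ jH).
  have ej : e (s j) = j by rewrite /e ds; lia.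
  have lj : (j < H.+1)%N by lia.
  have := mx (Ordinal lj); rewrite /P /= ej leqnn subnn eqxx => /(_ isT).
  by move: le; rewrite ej; lia.
exists br; split.
- by move=> w wX; have [/andP[le /eqP eq] _] := brP _ wX.
- move=> j jH w; rewrite inE => /and3P[wX /eqP bw jw].
  have [dw pw] := hX _ wX.
  split; first by rewrite ds //; lia.
  have [/andP[_ /eqP iw] mw] := brP _ wX; rewrite bw in iw.
  case: (ltnP j.+1 (e w)) => jw1; last first.
    by left; rewrite -iw (_ : e w - j = 1)%N //; rewrite /e in jw1 *; lia.
  right.
  have pX : par w \in X.
    by case: pw => // pv; move: (dep_par w); rewrite pv /e in jw1 *; lia.
  have ep : e (par w) = (e w).-1 by rewrite /e dep_par; lia.
  (* [w] and its parent have the same spine ancestors above the level of [w], so the two maxima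
     agree. *)
  have PP (i : 'I_H.+1) : (i < e w)%N -> P (par w) i = P w i.
    move=> ie; rewrite /P ep -iterSr (_ : ((e w).-1 - i).+1 = e w - i)%N; last lia.
    by congr andb; lia.
  have [Pp mp] := brP _ pX.
  rewrite inE pX /=; apply/andP; split; last by rewrite -/(e _) ep; lia.
  have lt1 : (br (par w) < e w)%N by move/andP: Pp => [+ _]; rewrite ep; lia.
  rewrite eqn_leq; apply/andP; split.
    by rewrite -bw; apply: mw; rewrite -PP.
  by rewrite -bw; apply: mp; rewrite PP ?bw ?(ltnW jw1) //; case: (brP _ wX).
- rewrite -[RHS]sum1_card (partition_big br predT) //=.
  have -> : (\sum_(j < H.+1) #|branch v X br j| + H =
      \sum_(j < H.+1) (#|branch v X br j| + (0 < j)))%N.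
    rewrite big_split /=; congr addn.
    by rewrite big_ord_recl /= add0n sum1_card card_ord.
  apply: eq_bigr => j _.
  rewrite (bigID (fun w => j < e w)%N) /=; congr addn.
    by rewrite -sum1_card; apply: eq_bigl => w; rewrite !inE -val_eqE andbA.
  case: (posnP j) => [j0|jp].
    rewrite big_pred0 // => w; apply/negP => /andP[/andP[wX _]].
    by have [] := hX _ wX; rewrite /e j0; lia.
  have jH : (0 < j <= H)%N by have := ltn_ord j; lia.
  rewrite (big_pred1 (s j)) // => w; apply/idP/eqP => [|->].
    move=> /andP[/andP[wX /eqP bw] ew]; have [/andP[le /eqP iw] _] := brP _ wX.
    by move: iw; rewrite bw (_ : e w - j = 0)%N //; lia.
  rewrite sX //= -val_eqE /= br_s // eqxx /e ds; last by case/andP: jH.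
  by lia.
Qed.

Definition cost (F : realFieldType) (c : nat -> F) (L : seq (T * nat)) : F :=
  \sum_(b <- L) c b.2.

Lemma cost_flatten (F : realFieldType) (c : nat -> F) (I : finType)
    (P : pred I) (L : I -> seq (T * nat)) :
  cost c (flatten [seq L i | i <- enum P]) = \sum_(i | P i) cost c (L i).
Proof. by rewrite /cost big_flatten /= big_map big_enum. Qed.

Lemma near_spine (u w : T) (H i j m r : nat) :
  (i <= H)%N -> (j <= H)%N -> iter m par w = iter (H - i) par u ->
  (m + (i - j) + (j - i) <= r)%N -> near w (iter (H - j) par u) r.
Proof.
move=> iH jH e le; case: (leqP j i) => ij.
  exists (i - j + m)%N, 0%N; split; first by lia.
  by rewrite iterD e /= -iterD; congr iter; lia.
exists m, (j - i)%N; split; first by lia.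
by rewrite e -iterD; congr iter; lia.
Qed.

(** The final tile is the last [l] positions, and [i] is the offset of [j] in it. Before the centre
    [m <= i] suffices; past the centre [j + m <= H] does, as no branch reaches deeper than the
    spine. *)
Lemma last_ball_reach (H l i j m : nat) :
  (l <= H + H)%N -> (i < l)%N -> (j + l = H + i + 1)%N -> (m <= i)%N ->
  (j + m <= H)%N ->
  (H.+1 - (l - l./2) <= H)%N /\
  (m + (j - (H.+1 - (l - l./2))) + (H.+1 - (l - l./2) - j) <= l./2)%N.
Proof.
have := odd_double_half l; case: (odd l) => /=; move: (l./2) => f.
  by move=> <- *; split; lia.
by move=> <- *; split; lia.
Qed.

(** * Covering a hanging part under a given price function *)

Section ForestCover.
Variables (F : realFieldType) (c : nat -> F) (R : nat) (W : F).
Hypothesis c_ge0 : forall r, 0 <= c r.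

(* [L n] need only cover what a ball of radius n around [v] leaves uncovered;
   bounding the sum over n bounds the mean price for a uniform n < R. *)
Definition coverable_below (v : T) (X : {set T}) : Prop :=
  exists L : nat -> seq (T * nat),
  [/\ forall n w, (n < R)%N -> w \in X -> (n < dep w - dep v)%N -> covered (L n) w,
      forall n b, b \in L n -> (b.2 <= R)%N &
      \sum_(n < R) cost c (L n) <= W * #|X|%:R].

Lemma cost_ge0 (L : seq (T * nat)) : 0 <= cost c L.
Proof. by apply: sumr_ge0. Qed.

Section Spine.
Variables (v u : T) (X : {set T}) (H : nat) (br : T -> 'I_H.+1).
Hypothesis H_eq : H = (dep u - dep v)%N.
Hypothesis X_low : forall w, w \in X -> (dep w <= dep u)%N.
Hypothesis br_le : forall w, w \in X -> (br w <= dep w - dep v)%N.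
Hypothesis br_iter : forall w, w \in X ->
  iter (dep w - dep v - br w) par w = iter (H - br w) par u.
Hypothesis X_card : (\sum_(j < H.+1) #|branch v X br j| + H = #|X|)%N.
Variable Lo : 'I_H.+1 -> nat -> seq (T * nat).
Hypothesis Lo_cover : forall (j : 'I_H.+1) n w, (n < R)%N -> w \in branch v X br j ->
  (n < dep w - dep v - j)%N -> covered (Lo j n) w.
Hypothesis Lo_radius : forall j n b, b \in Lo j n -> (b.2 <= R)%N.
Hypothesis Lo_cost : forall j : 'I_H.+1,
  \sum_(n < R) cost c (Lo j n) <= W * #|branch v X br j|%:R.

Lemma spine_card_le (x : F) : x <= W * H%:R ->
  x + \sum_(j < H.+1) \sum_(n < R) cost c (Lo j n) <= W * #|X|%:R.
Proof.
move=> xH; rewrite -X_card natrD mulrDr addrC lerD // natr_sum mulr_sumr.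
by apply: ler_sum => j _; apply: Lo_cost.
Qed.

Lemma covered_branch (w : T) (n : nat) (L : seq (T * nat)) :
  (n < R)%N -> w \in X -> (n < dep w - dep v - br w)%N -> {subset Lo (br w) n <= L} ->
  covered L w.
Proof.
move=> nR wX nw sub.
have [|b bL nb] := @Lo_cover (br w) n w nR _ nw; last by exists b => //; apply: sub.
by rewrite inE wX eqxx /=; lia.
Qed.

(** For a need [n < H], one ball of radius [H - n - 1] at position [n + 1] covers the rest of the
    spine and all branches leaving beyond position [n]; a branch leaving at [j <= n] inherits the
    need [n - j]. Over all [n] these radii run once through those below [H]. *)
Lemma coverable_short_spine :
  (H < R)%N -> \sum_(r < H) c r <= W * H%:R -> coverable_below v X.
Proof.
move=> HR cH.
pose off n := flatten
  [seq Lo j (n - j) | j <- enum [pred j : 'I_H.+1 | j <= n]%N].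
exists (fun n => if (n < H)%N then
  (iter (H - n.+1) par u, (H - n.+1)%N) :: off n else [::]).
split.
- move=> n w nR wX nw; have wu := X_low wX; have bw := br_le wX.
  have nH : (n < H)%N by lia.
  rewrite nH; case: (leqP (br w) n) => bn.
    apply: (@covered_branch _ (n - br w)%N) => //; first by lia.
      by lia.
    move=> b bL; rewrite inE; apply/orP; right.
    apply/flattenP; exists (Lo (br w) (n - br w)) => //.
    by apply/mapP; exists (br w); rewrite // mem_enum.
  exists (iter (H - n.+1) par u, (H - n.+1)%N); first exact: mem_head.
  by apply: (near_spine _ _ (br_iter wX)) => /=; have := ltn_ord (br w); lia.
- move=> n b; case: ltnP => // nH; rewrite inE => /orP[/eqP-> /=|]; first by lia.
  by move=> /flattenP[_ /mapP[j _ ->]]; apply: Lo_radius.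
- apply: le_trans (spine_card_le cH).
  have -> : \sum_(r < H) c r =
      \sum_(n < R) (if (n < H)%N then c (H - n.+1)%N else 0).
    rewrite -big_mkcond (big_ord_narrow (ltnW HR)) /=.
    by rewrite (reindex_inj rev_ord_inj).
  apply: (@le_trans _ _ (\sum_(n < R) ((if (n < H)%N then c (H - n.+1)%N else 0)
     + \sum_(j < H.+1) (if (j <= n)%N then cost c (Lo j (n - j)) else 0)))).
    apply: ler_sum => n _; case: ifP => nH.
      by rewrite /cost big_cons -/(cost c _) cost_flatten -big_mkcond lexx.
    rewrite {1}/cost big_nil add0r; apply: sumr_ge0 => j _.
    by case: ifP => // _; apply: cost_ge0.
  rewrite big_split lerD2l exchange_big /=; apply: ler_sum => j _.
  rewrite (sum_subn (fun k => cost c (Lo j k))).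
  apply: (ler_sum_ord (f := fun k => cost c (Lo j k))); last exact: leq_subr.
  by move=> i; apply: cost_ge0.
Qed.

(** Over the [2R] phases there are [H + 1 - R] full tiles, the final balls take each radius below
    [R] twice, and each branch sees every need twice. The two price hypotheses bound the share of
    the spine by [2 W H]. *)
Lemma coverable_tall_spine : (0 < R <= H)%N -> c R <= W *+ 2 ->
  c R + (\sum_(r < R) c r) *+ 2 <= (W *+ 2) * R%:R -> coverable_below v X.
Proof.
move=> /andP[R0 RH] cR cS.
(* For the phase [b], [K b] full tiles are followed by a shorter one of [la b]
   vertices, and the branch at the position [j] finds the depths up to [nd b j]
   covered. At [j = 0] the ball around [v] plays the role of a tile boundary. *)
pose K b := ((H + R - b) %/ (R + R))%N.
pose la b := ((H + R - b) %% (R + R))%N.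
pose s j := iter (H - j) par u.
pose ix b j := ((j + R + R + R - 1 - b) %% (R + R))%N.
pose nd b (j : 'I_H.+1) :=
  if (j : nat) is 0 then b./2 else minn (ix b j) (R + R - 1 - ix b j).
pose main b := (s (H.+1 - (la b - (la b)./2))%N, (la b)./2) ::
  [seq (s (b + k * (R + R) + 1)%N, R) | k <- iota 0 (K b)].
pose L b := main b ++ flatten [seq Lo j (nd b j) | j <- enum 'I_H.+1].
have RR0 : (0 < R + R)%N by lia.
have la_lt b : (la b < R + R)%N by rewrite ltn_mod.
have nd_lt b (j : 'I_H.+1) : (b < R + R)%N -> (nd b j < R)%N.
  move=> bR; rewrite /nd; case: (j : nat) => [|j'].
    by have := odd_double_half b; lia.
  by move: (ix b j) => x; rewrite /minn; case: ifP; lia.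
have L_cover b w : (b < R + R)%N -> w \in X ->
    (b./2 < dep w - dep v)%N -> covered (L b) w.
  move=> bR wX bw.
  have wu := X_low wX; have jw := br_le wX; have iw := br_iter wX.
  set j := br w in jw iw; have jH := ltn_ord j.
  case: (ltnP (nd b j) (dep w - dep v - j)) => [lt|ge].
    apply: (covered_branch (nd_lt b j bR) wX lt) => x xL.
    rewrite mem_cat; apply/orP; right; apply/flattenP.
    by exists (Lo j (nd b j)) => //; apply/mapP; exists j; rewrite // mem_enum.
  have j0 : (0 < j)%N by case: (posnP j) ge => // j0; rewrite /nd j0; lia.
  have {}ge : (dep w - dep v - j <= minn (ix b j) (R + R - 1 - ix b j))%N.
    by move: ge; rewrite /nd; case: (j : nat) j0.
  (* A position before the first tile would put [w] at most [b - R <= b./2] below [v], against the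
     assumption on its depth. *)
  have bj : (b <= j - 1 + R)%N.
    rewrite leqNgt; apply/negP => jb.
    have ixE : ix b j = (j + R + R + R - 1 - b)%N.
      by rewrite /ix modn_small //; lia.
    by move: ge; rewrite ixE; lia.
  (* [y] counts from the start of the first tile, at [b + 1 - R]: its quotient by [2R] is the tile,
     its remainder [ix b j] the offset. *)
  set y := (j - 1 + R - b)%N.
  have ixE : ix b j = (y %% (R + R))%N.
    rewrite /ix (_ : j + R + R + R - 1 - b = y + (R + R))%N ?modnDr //.
    by rewrite /y; lia.
  have yE := divn_eq y (R + R); rewrite -ixE in yE.
  have iR : (ix b j < R + R)%N by rewrite ltn_mod.
  have hE := divn_eq (H + R - b) (R + R); rewrite -/(K b) -/(la b) in hE.
  have lab := la_lt b.
  set i := ix b j in ge yE iR; set q := (y %/ (R + R))%N in yE.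
  rewrite /y in yE.
  case: (ltnP q (K b)) => qK.
    exists (s (b + q * (R + R) + 1)%N, R).
      rewrite mem_cat inE; apply/orP; left; apply/orP; right.
      by apply/mapP; exists q; rewrite // mem_iota.
    have : (q * (R + R) + (R + R) <= K b * (R + R))%N.
      by rewrite -mulSnr leq_mul2r qK orbT.
    move: yE hE; move: (q * (R + R))%N (K b * (R + R))%N => A B yE hE AB.
    have jm : (j <= H)%N by clear - jH; lia.
    apply: (near_spine jm _ iw) => /=; first by clear - yE hE AB bj bR R0 RH; lia.
    by clear - yE hE AB bj bR R0 RH ge iR j0; lia.
  have qE : q = K b.
    apply/eqP; rewrite eqn_leq qK andbT leqNgt; apply/negP => Kq.
    have : (K b * (R + R) + (R + R) <= q * (R + R))%N.
      by rewrite -mulSnr leq_mul2r Kq orbT.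
    move: yE hE; move: (q * (R + R))%N (K b * (R + R))%N => A B yE hE AB.
    by lia.
  rewrite qE in yE.
  exists (s (H.+1 - (la b - (la b)./2))%N, (la b)./2).
    by rewrite mem_cat inE eqxx.
  move: yE hE; move: (K b * (R + R))%N => A yE hE.
  have jm : (j + (dep w - dep v - j) <= H)%N by clear - jw wu H_eq; lia.
  have yl : (i < la b)%N by clear - yE hE bR bj j0 jH; lia.
  have [le1 le2] : (H.+1 - (la b - (la b)./2) <= H)%N /\
      (dep w - dep v - j + (j - (H.+1 - (la b - (la b)./2))) +
      (H.+1 - (la b - (la b)./2) - j) <= (la b)./2)%N.
    move: (la b) lab yE hE yl => l lab yE hE yl; move: ge; rewrite leq_min.
    move=> /andP[ge _]; apply: last_ball_reach ge _ => //; try exact: jm.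
      by clear - lab RH; lia.
    by clear - yE hE bR bj j0 RH; lia.
  by apply: (near_spine _ _ iw).
have L_radius b x : x \in L b -> (x.2 <= R)%N.
  rewrite mem_cat => /orP[|/flattenP[_ /mapP[j _ ->]]]; last exact: Lo_radius.
  rewrite inE => /orP[/eqP-> /=|/mapP[k _ ->] //].
  by have := la_lt b; have := odd_double_half (la b); lia.
have L_cost : \sum_(b < R + R) cost c (L b) <= W * #|X|%:R *+ 2.
  have costL b : cost c (L b) = c R * (K b)%:R + c (la b)./2 +
      \sum_(j < H.+1) cost c (Lo j (nd b j)).
    rewrite /cost big_cat /= -/(cost c (flatten _)) cost_flatten big_cons big_map.
    rewrite /= big_const_seq count_predT size_iota iter_addr_0 mulr_natr.
    by rewrite [c _ + _]addrC.
  under eq_bigr => b _ do rewrite costL.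
  rewrite !big_split /= -mulr_sumr.
  have EK : \sum_(b < R + R) ((K b)%:R : F) = (H.+1 - R)%:R.
    rewrite /K sum_subn_divn; last by lia.
    by congr (_%:R); lia.
  have El : \sum_(b < R + R) c (la b)./2 = (\sum_(r < R) c r) *+ 2.
    rewrite /la (sum_subn_modn (fun x => c x./2)); last by lia.
    exact: sum_half.
  have Eo : \sum_(b < R + R) \sum_(j < H.+1) cost c (Lo j (nd b j)) =
      (\sum_(j < H.+1) \sum_(n < R) cost c (Lo j n)) *+ 2.
    rewrite exchange_big -sumrMnl; apply: eq_bigr => j _ /=.
    rewrite /nd; case: (j : nat) => [|j'].
      exact: (sum_half (fun n => cost c (Lo j n))).
    rewrite -(sum_reflect (fun n => cost c (Lo j n))).
    rewrite /ix (sum_subn_modn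
      (fun x => cost c (Lo j (minn x (R + R - 1 - x))))) //.
    by lia.
  rewrite EK El Eo.
  have := @spine_card_le (W * H%:R) (lexx _).
  set S := \sum_(j < H.+1) _ => hS.
  have -> : (H.+1 - R)%:R = 1 + H%:R - R%:R :> F.
    by rewrite natrB ?(leqW RH) // -natr1 [_ + 1]addrC.
  have RH' : 0 <= H%:R - R%:R :> F by rewrite subr_ge0 ler_nat.
  have hW := ler_wpM2r RH' cR.
  rewrite !mulr2n in hW cS *; lra.
(* The phases 2n and 2n+1 both suit the need n, so take the cheaper one. *)
exists (fun n => if cost c (L n.*2) <= cost c (L n.*2.+1)
  then L n.*2 else L n.*2.+1).
split.
- move=> n w nR wX nw; case: ifP => _; apply: L_cover => //=.
  + by lia.
  + by rewrite doubleK.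
  + by lia.
  + by rewrite uphalf_double.
- by move=> n b; case: ifP => _; apply: L_radius.
- rewrite -(ler_pMn2r (n := 2)) //; apply: le_trans L_cost.
  rewrite (sum_pairs (fun b => cost c (L b))) -sumrMnl.
  apply: ler_sum => n _; rewrite mulr2n.
  by case: ifP => [le|/negbT]; rewrite -?ltNge => *; rewrite ?lerD2l ?lerD2r // ltW.
Qed.

End Spine.

(** Induction on the size of [X]. The spine runs to a deepest vertex, so no branch reaches below its
    end; its length against [R] decides between a single ball and a tiling. *)
Lemma hang_coverable (v : T) (X : {set T}) :
  (0 < R)%N -> (forall h, (h <= R)%N -> \sum_(r < h) c r <= W * h%:R) ->
  c R <= W *+ 2 -> c R + (\sum_(r < R) c r) *+ 2 <= (W *+ 2) * R%:R ->
  hang v X -> coverable_below v X.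
Proof.
move=> R0 cW cR cS; have [m] := ubnP #|X|.
elim: m v X => // m IH v X Xm hX.
have [->|[u0 u0X]] := set_0Vmem X.
  exists (fun=> [::]); split => //; first by move=> n w _; rewrite inE.
  by rewrite cards0 mulr0 big1 // => i _; rewrite /cost big_nil.
pose u := [arg max_(w > u0 in X) dep w]%N.
have [uX umax] : u \in X /\ forall w, w \in X -> (dep w <= dep u)%N.
  by rewrite /u; case: arg_maxnP.
have [duv _] := hX _ uX.
have [br [br_ok br_hang br_card]] := spine_decomposition hX uX umax.
set H := (dep u - dep v)%N in br br_ok br_hang br_card.
have subforest (j : 'I_H.+1) : exists L : nat -> seq (T * nat),
  [/\ forall n w, (n < R)%N -> w \in branch v X br j ->
        (n < dep w - dep v - j)%N -> covered (L n) w,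
      forall n b, b \in L n -> (b.2 <= R)%N &
      \sum_(n < R) cost c (L n) <= W * #|branch v X br j|%:R].
  have jH := ltn_ord j.
  have [] // := IH _ _ _ (br_hang j _).
    by move: Xm; rewrite -br_card (bigD1 j) //= /H; lia.
  move=> L [cL rL sL]; exists L; split => // n w nR wB nw; apply: cL => //.
  by rewrite dep_iter; move: nw; rewrite /H in jH *; lia.
have [Lo Lo_ok] := fin_all_exists subforest.
have Lo_cover (j : 'I_H.+1) n w := let: And3 h _ _ := Lo_ok j in h n w.
have Lo_radius (j : 'I_H.+1) n b := let: And3 _ h _ := Lo_ok j in h n b.
have Lo_cost (j : 'I_H.+1) := let: And3 _ _ h := Lo_ok j in h.
have br_le w wX := proj1 (br_ok w wX).
have br_iter w wX := proj2 (br_ok w wX).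
case: (ltnP H R) => HR.
  apply: (coverable_short_spine (erefl H) umax br_le br_iter br_card
    Lo_cover Lo_radius Lo_cost HR).
  by apply: cW; rewrite ltnW.
apply: (coverable_tall_spine (erefl H) umax br_le br_iter br_card
    Lo_cover Lo_radius Lo_cost) => //.
by rewrite R0 HR.
Qed.

End ForestCover.

(** * Rounding radii up to classes of multiples of [d] *)

Section Classes.
Variables (F : realFieldType) (D d : nat) (P : 'I_D.+1 -> F) (rho : F).
Hypotheses (D_gt0 : (0 < D)%N) (d_gt0 : (0 < d)%N).
Hypothesis P_ge0 : forall q, 0 <= P q.
Hypothesis rho_ge0 : 0 <= rho.
Hypothesis rho_ge : d%:R * \sum_q P q <= rho * (D * d)%:R ^+ 2.

(** A radius may be rounded up to any larger class; taking the cheapest makes the price monotone in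
    the radius. The default [ord_max] is admissible for [r <= D * d]. *)
Definition best_class (r : nat) : 'I_D.+1 :=
  [arg min_(q < ord_max | (r <= q * d)%N) P q]%O.

Lemma best_classP (r : nat) : (r <= D * d)%N ->
  (r <= best_class r * d)%N /\
  forall q : 'I_D.+1, (r <= q * d)%N -> P (best_class r) <= P q.
Proof. by move=> rD; rewrite /best_class; case: arg_minP. Qed.

Lemma best_class_mono (r s : nat) : (r <= s <= D * d)%N ->
  P (best_class r) <= P (best_class s).
Proof.
move=> /andP[rs sD]; have [sb _] := best_classP sD.
have [_] := best_classP (leq_trans rs sD); apply; exact: leq_trans sb.
Qed.

Lemma sum_best_class :
  \sum_(r < (D * d).+1) P (best_class r) <= d%:R * \sum_q P q.
Proof.
suff sub m : (m <= D)%N -> \sum_(r < (m * d).+1) P (best_class r) <=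
    d%:R * \sum_(i < m.+1) P (inord i).
  apply: le_trans (sub _ (leqnn D)) _; rewrite ler_pM2l ?ltr0n //.
  by apply: ler_sum => i _; rewrite inord_val.
elim: m => [_|m IH mD].
  rewrite mul0n !big_ord1; have [_] := best_classP (leq0n _).
  move=> /(_ (inord 0) (leq0n _)) /le_trans; apply.
  by rewrite ler_peMl // ler1n.
rewrite mulSn addnC -addSn big_split_ord [in leRHS]big_ord_recr mulrDr /=.
apply: lerD; first exact/IH/ltnW.
rewrite mulr_natl -[X in _ *+ X]card_ord -sumr_const ler_sum // => t _.
have tq : ((m * d).+1 + t <= m.+1 * d)%N by rewrite mulSn; have := ltn_ord t; lia.
have tD : ((m * d).+1 + t <= D * d)%N.
  by apply: leq_trans tq _; rewrite leq_mul2r mD orbT.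
by apply: (best_classP tD).2; rewrite inordK.
Qed.

(** For the least [R] whose prices up to [R] sum to at most [rho R^2], all price conditions hold
    with [W = rho R]. The mean over the needs is then at most [rho |X|], so a cheapest need obeys
    this bound, and the depths up to it fall to the ball of radius [D d] at [v]. *)
Lemma hang_class_cover (v : T) (X : {set T}) : hang v X ->
  exists2 L : seq (T * 'I_D.+1),
    forall u, u \in X ->
      (exists2 b, b \in L & near u b.1 (b.2 * d)) \/ near u v (D * d) &
    \sum_(b <- L) P b.2 <= rho * #|X|%:R.
Proof.
move=> hX; pose c r := P (best_class r).
pose good R := (0 < R)%N && (\sum_(r < R.+1) c r <= rho * R%:R ^+ 2).
have Dd0 : (0 < D * d)%N by rewrite muln_gt0 D_gt0.
have goodD : good (D * d)%N.
  by rewrite /good Dd0; apply: le_trans sum_best_class rho_ge.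
have goodE : exists R, good R by exists (D * d)%N.
(* The least good R has [c R <= rho (2R - 1)], since R - 1 is not good. *)
case: (ex_minnP goodE) => R /andP[R0 cR] Rmin.
have RD := Rmin _ goodD.
have c0 r : 0 <= c r by apply: P_ge0.
have R0F : 0 < R%:R :> F by rewrite ltr0n.
have S0 n : 0 <= \sum_(r < n) c r by apply: sumr_ge0.
have cRW : c R <= (rho * R%:R) *+ 2.
  have [R1|R1] := leqP R 1.
    have E : R = 1%N by lia.
    have c1 : c R <= \sum_(r < R.+1) c r by rewrite big_ord_recr lerDr.
    apply: le_trans c1 (le_trans cR _).
    by rewrite E expr1n !mulr1 mulr2n lerDl.
  have : ~~ good R.-1.
    by apply/negP => /Rmin; lia.
  rewrite /good (_ : (0 < R.-1)%N) /= ?prednK //; last by lia.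
  rewrite -ltNge => lt; move: cR; rewrite big_ord_recr /= => cR.
  have RE : R%:R = R.-1%:R + 1 :> F by rewrite natr1 prednK.
  move: lt cR; rewrite RE; set x := R.-1%:R => lt cR.
  have x0 : 0 <= x by rewrite ler0n.
  rewrite mulr2n; have := rho_ge0; lra.
have [] // := @hang_coverable F c R (rho * R%:R) c0 v X R0.
- move=> h hR; rewrite -(ler_pM2l (x := R.+1%:R)) ?ltr0n //.
  apply: (le_trans (mean_prefix_le (f := c) (n := R.+1) _ (leqW hR))).
    move=> i j /andP[ij jR]; apply: best_class_mono; rewrite ij /=.
    by apply: leq_trans RD; rewrite -ltnS.
  apply: le_trans (ler_wpM2l (ler0n _ h) cR) _.
  have -> : R.+1%:R = R%:R + 1 :> F by rewrite natr1.
  have : 0 <= h%:R * (rho * R%:R) by rewrite !mulr_ge0.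
  by lra.
- move: cR; rewrite big_ord_recr /= => cR; have := c0 R.
  by rewrite !mulr2n; nra.
move=> L [cL rL sL].
pose n := [arg min_(i < Ordinal R0 | true) cost c (L i)]%O.
have cn : cost c (L n) <= rho * #|X|%:R.
  rewrite -(ler_pM2l R0F) mulrCA mulrA; apply: le_trans sL.
  rewrite mulr_natl -[X in _ *+ X]card_ord -sumr_const ler_sum // => i _.
  by rewrite /n; case: arg_minP => // j _; apply.
exists [seq (b.1, best_class b.2) | b <- L n].
  move=> u uX; have [du _] := hX _ uX; have nR := ltn_ord n.
  case: (ltnP n (dep u - dep v)) => nu.
    left; have [b bL nb] := cL _ _ nR uX nu.
    exists (b.1, best_class b.2); first exact: map_f.
    apply: near_le nb => /=.
    by apply: (best_classP _).1; apply: leq_trans (rL _ _ bL) RD.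
  right; exists (dep u - dep v)%N, 0%N; split.
    by rewrite addn0 (leq_trans nu) // (leq_trans (ltnW nR)).
  by rewrite (hang_top hX uX).
by rewrite big_map.
Qed.

End Classes.

(** * Cutting the tree into parts of bounded size *)

Definition upclosed (Y : {set T}) : Prop := forall u, u \in Y -> par u \in Y.

(** Start with everything below the root. While more than [2M] vertices hang below [v], take the
    subtree [S] of a child [c]: either at least [M] vertices remain without [S], or [S] without [c]
    has at least [M]. *)
Lemma chunk_exists (root : T) (Y : {set T}) (M : nat) :
  dep root = 0%N -> (forall u, dep u = 0%N -> u = root) ->
  upclosed Y -> (M < #|Y|)%N ->
  exists v X, [/\ hang v X, X \subset Y, upclosed (Y :\: X) &
                  (M <= #|X| <= 2 * M)%N].
Proof.
move=> root0 rootP Yup MY.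
pose good v (X : {set T}) := [/\ hang v X, X \subset Y,
  forall u, u \in Y -> par u \in X -> u \in X & (M <= #|X|)%N].
have [v [X gX]] : exists v X, good v X.
  exists root, (Y :\ root); split.
  - move=> u; rewrite !inE => /andP[ur uY]; split.
      by rewrite root0 lt0n; apply: contra_neq ur; apply: rootP.
    by case: (eqVneq (par u) root) => [->|pr]; [left|right; rewrite ?inE ?pr Yup].
  - exact: subsetDl.
  - move=> u uY; rewrite !inE uY andbT => /andP[pr _]; apply: contra_neq pr.
    by move=> ->; apply: rootP; rewrite dep_par root0.
  - by move: MY; rewrite (cardsD1 root); case: (root \in Y) => /=; lia.
have [m] := ubnP #|X|; elim: m v X gX => // m IH v X [hX XY Xdown MX] Xm.
have [X2|X2] := leqP #|X| (2 * M).
  exists v, X; split; rewrite ?MX // => u; rewrite !inE => /andP[uX uY].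
  by rewrite Yup // andbT; apply: contra uX; apply: Xdown.
have vX : v \notin X by apply/negP => /hX []; rewrite ltnn.
have [c cX cv] : exists2 c, c \in X & par c = v.
  have [X0|[u uX]] := set_0Vmem X; first by move: X2; rewrite X0 cards0; lia.
  have [du _] := hX _ uX; exists (iter (dep u - dep v).-1 par u).
    by apply: (hang_iter hX uX); lia.
  by rewrite -iterS prednK ?subn_gt0 // (hang_top hX).
have dc : (dep v < dep c)%N by case: (hX _ cX).
pose S := [set w in X | (dep c <= dep w)%N && (iter (dep w - dep c) par w == c)].
have cS : c \in S by rewrite inE cX leqnn subnn /=.
have SX : S \subset X by apply/subsetP => w; rewrite inE => /andP[].
have S_up w : w \in S -> w != c -> (dep c < dep w)%N /\ par w \in S.
  rewrite inE => /and3P[wX dw /eqP iw] wc.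
  have lt : (dep c < dep w)%N.
    rewrite ltn_neqAle dw andbT; apply: contra_neq wc => e.
    by rewrite -iw e subnn.
  have [dvw pw] := hX _ wX; split => //.
  have pX : par w \in X.
    by case: pw => // pv; have := dep_par w; rewrite pv; lia.
  rewrite inE pX dep_par -iterSr (_ : (_ - dep c).+1 = dep w - dep c)%N; last by lia.
  by rewrite iw eqxx andbT; lia.
have S_down w : w \in X -> par w \in S -> w \in S.
  move=> wX; rewrite !inE wX => /and3P[_]; rewrite dep_par => dw /eqP iw.
  have [dvw _] := hX _ wX.
  have -> : iter (dep w - dep c) par w = c.
    by rewrite -[RHS]iw -iterSr; congr iter; lia.
  by rewrite eqxx andbT; lia.
clearbody S.
have cardS : (#|S| + #|X :\: S| = #|X|)%N.
  by rewrite -(cardsID S X) (setIidPr SX).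
have [XS|XS] := leqP M #|X :\: S|.
  apply: (IH v (X :\: S)); last first.
    by move: Xm; rewrite -cardS (cardsD1 c S) cS; lia.
  split=> //.
  - move=> w; rewrite !in_setD => /andP[wS wX]; have [dw pw] := hX _ wX.
    split=> //; case: pw => [|pX]; [by left|right]; rewrite pX andbT.
    by apply: contra wS; apply: S_down.
  - exact: subset_trans (subsetDl _ _) XY.
  - move=> u uY; rewrite !in_setD => /andP[pS pX]; have uX := Xdown _ uY pX.
    apply/andP; split; last exact: uX.
    apply/negP => uS.
    have [uc|uc] := eqVneq u c.
      by move: pX; rewrite uc cv (negPf vX).
    have [_ pS'] := S_up _ uS uc.
    by rewrite pS' in pS.
apply: (IH c (S :\ c)); last by move: Xm; rewrite -cardS (cardsD1 c S) cS; lia.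
split.
- move=> w; rewrite in_setD1 => /andP[wc wS]; have [dw pS] := S_up _ wS wc.
  by split=> //; case: (eqVneq (par w) c) => [|pc]; [left|right; rewrite in_setD1 pc].
- exact: subset_trans (subsetDl _ _) (subset_trans SX XY).
- move=> u uY; rewrite !in_setD1 => /andP[pc pS].
  have pX := subsetP SX _ pS.
  have uX := Xdown _ uY pX.
  apply/andP; split; last exact: S_down uX pS.
  by apply: contraNneq vX => uc; rewrite -cv -uc.
- by move: X2; rewrite -cardS (cardsD1 c S) cS; lia.
Qed.

(** * Controlling all class loads by a potential *)

Section Assembly.
Variables (F : realFieldType) (D d M : nat) (root : T) (a B theta kappa : F).
Hypotheses (D_gt0 : (0 < D)%N) (d_gt0 : (0 < d)%N).
Hypotheses (dep_root : dep root = 0%N) (rootP : forall u, dep u = 0%N -> u = root).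
Hypotheses (a_ge0 : 0 <= a) (a_eq : a * (D * d)%:R ^+ 2 = d%:R).
Hypotheses (B_ge0 : 0 <= B) (theta_gt0 : 0 < theta) (kappa_ge1 : 1 <= kappa).
Hypothesis kappa_eq : kappa * theta = D.+1%:R * (B + theta).

(** The allowed growth of the potential per covered vertex: a first-order term from [theta] and a
    second-order term from parts of up to [2M] vertices. *)
Let A : F :=
  (theta * a * D.+1%:R) *+ 2 + (D.+1%:R * kappa ^+ 2 * a ^+ 2 * M%:R) *+ 2.
Hypothesis A_le : A * #|T|%:R <= B ^+ 2.

Definition load (U : seq (T * 'I_D.+1)) (q : 'I_D.+1) : nat :=
  count (fun b => b.2 == q) U.

Definition excess (U : seq (T * 'I_D.+1)) (s : nat) (q : 'I_D.+1) : F :=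
  Num.max 0 ((load U q)%:R - a * s%:R).

Definition potential (U : seq (T * 'I_D.+1)) (s : nat) : F :=
  \sum_q excess U s q ^+ 2.

Lemma excess_ge0 (U : seq (T * 'I_D.+1)) (s : nat) (q : 'I_D.+1) :
  0 <= excess U s q.
Proof. by rewrite /excess le_max lexx. Qed.

Lemma sum_load (P : 'I_D.+1 -> F) (L : seq (T * 'I_D.+1)) :
  \sum_(b <- L) P b.2 = \sum_q P q * (load L q)%:R.
Proof.
rewrite (partition_big (fun b => b.2) predT) //=; apply: eq_bigr => q _.
rewrite (eq_bigr (fun=> P q)) => [|b /eqP->//].
by rewrite big_const_seq iter_addr_0 mulr_natr.
Qed.

Lemma excess_le_B (U : seq (T * 'I_D.+1)) (s : nat) (q : 'I_D.+1) :
  (s <= #|T|)%N -> potential U s <= A * s%:R -> excess U s q <= B.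
Proof.
move=> sT pot; rewrite -(ler_pXn2r (n := 2)) ?nnegrE ?excess_ge0 //.
have A0 : 0 <= A.
  by rewrite addr_ge0 ?mulrn_wge0 ?mulr_ge0 ?exprn_ge0 ?(ltW theta_gt0) //
    (le_trans _ kappa_ge1).
apply: le_trans A_le; apply: (@le_trans _ _ (A * s%:R)); last first.
  by rewrite ler_wpM2l // ler_nat.
apply: le_trans pot; rewrite /potential (bigD1 q) //= lerDl.
by apply: sumr_ge0 => i _; rewrite sqr_ge0.
Qed.

(* With the classes priced by their current excess plus [theta], the
   first-order change of the potential is at most of order [theta], and only
   the second-order terms in [A] remain. *)
Lemma potential_step (v : T) (X : {set T}) (U : seq (T * 'I_D.+1)) (s : nat) :
  hang v X -> (#|X| <= 2 * M)%N -> (s <= #|T|)%N ->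
  potential U s <= A * s%:R ->
  exists2 L : seq (T * 'I_D.+1),
    forall u, u \in X ->
      (exists2 b, b \in L & near u b.1 (b.2 * d)) \/ near u v (D * d) &
    potential (L ++ U) (s + #|X|) <= A * (s + #|X|)%:R.
Proof.
move=> hX X2 sT pot.
pose p q := excess U s q; pose P q := p q + theta.
have p0 q : 0 <= p q by apply: excess_ge0.
have P0 q : 0 <= P q by rewrite addr_ge0 // ltW.
have sP0 : 0 <= \sum_q P q by apply: sumr_ge0.
pose t := a * #|X|%:R.
have t0 : 0 <= t by rewrite mulr_ge0.
have [] := @hang_class_cover F D d P (a * \sum_q P q) D_gt0 d_gt0 P0 _ _ v X hX.
- by rewrite mulr_ge0.
- by rewrite mulrAC a_eq.
move=> L cL; rewrite sum_load mulrAC -/t => sL; exists L => //.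
have PB : \sum_q P q <= kappa * theta.
  rewrite kappa_eq mulr_natl -[X in _ *+ X](card_ord D.+1) -sumr_const.
  by apply: ler_sum => q _; rewrite lerD2r; apply: excess_le_B.
(* A ball costs at least [theta], so the total price caps the number taken from a single class. *)
have nk q : (load L q)%:R <= kappa * t.
  rewrite -(ler_pM2l theta_gt0).
  apply: (@le_trans _ _ (t * \sum_q P q)); last first.
    have -> : theta * (kappa * t) = t * (kappa * theta) by ring.
    by rewrite ler_wpM2l.
  apply: le_trans sL; rewrite (bigD1 q) //= ler_wpDr //.
    by apply: sumr_ge0 => i _; rewrite mulr_ge0.
  by rewrite ler_wpM2r // lerDr.
have step q : excess (L ++ U) (s + #|X|) q ^+ 2 <=
    p q ^+ 2 + (p q * ((load L q)%:R - t)) *+ 2 + (kappa * t) ^+ 2.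
  have -> : excess (L ++ U) (s + #|X|) q =
      Num.max 0 ((load U q)%:R - a * s%:R + ((load L q)%:R - t)).
    rewrite /excess /load count_cat !natrD mulrDr -/t; congr Num.max; ring.
  have : (load U q)%:R - a * s%:R <= p q by rewrite /p /excess le_max lexx orbT.
  have tk : t <= kappa * t by rewrite ler_peMl.
  by apply: max_sqr_le => //; rewrite ?ler0n ?nk ?t0.
apply: le_trans (ler_sum _ (fun q _ => step q)) _.
rewrite !big_split /=.
rewrite sumr_const card_ord -[_ *+ D.+1]mulr_natl.
(* By [sL] the load weighted by [P] is at most [t] times the sum of [P]; passing from [P] to [p]
   costs at most [theta * t] per class. *)
have lin : \sum_q p q * ((load L q)%:R - t) <= theta * t * D.+1%:R.
  have -> : \sum_q p q * ((load L q)%:R - t) =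
      \sum_q P q * (load L q)%:R - t * (\sum_q P q)
      - theta * \sum_q (load L q)%:R + theta * t * D.+1%:R.
    have -> : D.+1%:R = \sum_(q < D.+1) (1 : F).
      by rewrite sumr_const card_ord.
    rewrite !mulr_sumr -!sumrB -big_split /=; apply: eq_bigr => q _.
    by rewrite /P; ring.
  have : 0 <= theta * \sum_q (load L q)%:R.
    by rewrite mulr_ge0 ?(ltW theta_gt0) ?sumr_ge0.
  by lra.
have quad : D.+1%:R * (kappa * t) ^+ 2 <=
    (D.+1%:R * kappa ^+ 2 * a ^+ 2 * M%:R) *+ 2 * #|X|%:R.
  have -> : D.+1%:R * (kappa * t) ^+ 2 =
      D.+1%:R * kappa ^+ 2 * a ^+ 2 * #|X|%:R * #|X|%:R by rewrite /t; ring.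
  have X2' : #|X|%:R <= M%:R *+ 2 :> F by rewrite mulr2n -natrD ler_nat addnn -mul2n.
  have kappa0 : 0 <= kappa by apply: le_trans kappa_ge1.
  by rewrite ler_wpM2r // -mulrnAr ler_wpM2l // !mulr_ge0 ?exprn_ge0.
rewrite natrD mulrDr -addrA; apply: lerD; first exact: pot.
rewrite /A mulrDl; apply: lerD => //.
have {}lin : \sum_q p q * ((load L q)%:R - t) <= theta * a * D.+1%:R * #|X|%:R.
  by apply: le_trans lin _; rewrite /t le_eqVlt; apply/orP; left; apply/eqP; ring.
by rewrite mulrnAl mulr2n; apply: lerD.
Qed.

Definition class_covered (U : seq (T * 'I_D.+1)) (V : seq T) (u : T) : Prop :=
  (exists2 b, b \in U & near u b.1 (b.2 * d)) \/
  (exists2 v, v \in V & near u v (D * d)).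

(** Parts of [M] to [2M] vertices are detached until at most [M] remain; the remainder without the
    root is the last part. Hence there are at most [|T| / M + 1] parts, and the potential keeps each
    overrun within [B]. *)
Lemma cover_by_classes : (0 < M)%N ->
  exists (U : seq (T * 'I_D.+1)) (V : seq T),
  [/\ forall u, class_covered U V u,
      forall q, (load U q)%:R <= a * #|T|%:R + B &
      (size V * M <= #|T| + M)%N].
Proof.
move=> M0.
suff gen (m : nat) (Y : {set T}) (U : seq (T * 'I_D.+1)) (V : seq T) :
    (#|Y| <= m)%N -> upclosed Y ->
    (forall u, u \notin Y -> class_covered U V u) ->
    potential U (#|T| - #|Y|) <= A * (#|T| - #|Y|)%:R ->
    (size V * M <= #|T| - #|Y|)%N ->
  exists (U : seq (T * 'I_D.+1)) (V : seq T),
  [/\ forall u, class_covered U V u,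
      forall q, (load U q)%:R <= a * #|T|%:R + B &
      (size V * M <= #|T| + M)%N].
  apply: (gen #|T| setT [::] [::]); rewrite ?cardsT ?subnn ?mulr0 //.
    by move=> u; rewrite inE.
  by rewrite /potential big1 // => q _; rewrite /excess /= mulr0 subrr maxxx expr0n.
elim: m Y U V => [|m IH] Y U V Ym Yup cov pot szV.
  have Y0 : Y = set0 by apply/eqP; rewrite -cards_eq0; lia.
  exists U, V; split; first by move=> u; apply: cov; rewrite Y0 inE.
    move=> q; rewrite -lerBlDl; move: pot; rewrite Y0 cards0 subn0 => pot.
    by apply: le_trans (excess_le_B q (leqnn _) pot); rewrite /excess le_max lexx orbT.
  by lia.
have YT : (#|Y| <= #|T|)%N by apply: max_card.
have cov_step v (X : {set T}) (L : seq (T * 'I_D.+1)) : X \subset Y ->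
    (forall u, u \in X ->
      (exists2 b, b \in L & near u b.1 (b.2 * d)) \/ near u v (D * d)) ->
    forall u, u \notin Y :\: X ->
      class_covered (L ++ U) (v :: V) u.
  move=> XY covX u; rewrite in_setD negb_and negbK => /orP[/covX|/cov] [].
  - by move=> [b bL nb]; left; exists b; rewrite // mem_cat bL.
  - by move=> nv; right; exists v; rewrite // mem_head.
  - by move=> [b bU nb]; left; exists b; rewrite // mem_cat bU orbT.
  - by move=> [v' vV nv]; right; exists v'; rewrite // inE vV orbT.
have card_step (X : {set T}) : X \subset Y ->
    (#|T| - #|Y :\: X| = #|T| - #|Y| + #|X|)%N.
  by move=> XY; have := cardsID X Y; rewrite (setIidPr XY); lia.
have [YM|MY] := leqP #|Y| M.
  pose X := Y :\ root.
  have hX : hang root X.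
    move=> u; rewrite in_setD1 => /andP[ur uY]; split.
      by rewrite dep_root lt0n; apply: contra_neq ur; apply: rootP.
    by case: (eqVneq (par u) root) => [->|pr]; [left|right; rewrite in_setD1 pr Yup].
  have XY : X \subset Y by apply: subsetDl.
  have X2 : (#|X| <= 2 * M)%N by have := subset_leq_card XY; lia.
  have [|L covX pot'] := potential_step hX X2 _ pot; first by lia.
  have sX := card_step _ XY.
  exists (L ++ U), (root :: V); split.
  - move=> u; have [ur|ur] := eqVneq u root.
      by right; exists root; rewrite ?mem_head // ur; apply: nearxx.
    by apply: (cov_step root X L XY covX); rewrite in_setD in_setD1 ur; case: (u \in Y).
  - move=> q; rewrite -lerBlDl.
    have sT : (#|T| - #|Y| + #|X| <= #|T|)%N by rewrite -sX leq_subr.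
    apply: le_trans (excess_le_B q sT pot'); rewrite /excess le_max.
    by rewrite lerD2l lerN2 ler_wpM2l ?ler_nat ?orbT.
  - by rewrite /= mulSn addnC leq_add2r (leq_trans szV) ?leq_subr.
have [v [X [hX XY Xup /andP[MX X2]]]] := chunk_exists dep_root rootP Yup MY.
have [|L covX pot'] := potential_step hX X2 _ pot; first by lia.
have sX := card_step _ XY.
apply: (IH (Y :\: X) (L ++ U) (v :: V)) => //; rewrite ?sX //.
- by have := cardsID X Y; rewrite (setIidPr XY); lia.
- exact: cov_step.
- by rewrite /= mulSn addnC leq_add.
Qed.

End Assembly.
End Forest.

(** * Breadth-first trees and burning *)

Section Graph.
Variable G : sgraph.
Hypothesis G_conn : connected G.

Lemma walkP (u v : G) (r : nat) :
  reflect (exists p : seq G, [/\ size p = r, path (@adj G) u p & last u p = v])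
    (walk u v r).
Proof.
apply: (iffP existsP) => [[p /andP[up /eqP lp]]|[p [<- up lp]]].
  by exists p; rewrite size_tuple.
by exists (in_tuple p); rewrite /= up lp eqxx.
Qed.

Lemma dist_walk (u v : G) : walk u v (dist u v).
Proof. exact: (dist_minP (G_conn u v)).1. Qed.

Lemma walk_dist_le (u v : G) (r : nat) : walk u v r -> (dist u v <= r)%N.
Proof. exact: (dist_minP (G_conn u v)).2. Qed.

Lemma dist_triangle (u v w : G) : (dist u w <= dist u v + dist v w)%N.
Proof.
have [p [sp up lp]] := walkP _ _ _ (dist_walk u v).
have [q [sq vq lq]] := walkP _ _ _ (dist_walk v w).
apply: walk_dist_le; apply/walkP; exists (p ++ q).
by rewrite size_cat sp sq cat_path up lp vq last_cat lp lq.
Qed.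

Lemma dist_sym_le (u v : G) : (dist u v <= dist v u)%N.
Proof.
have [p [sp vp lp]] := walkP _ _ _ (dist_walk v u).
apply: walk_dist_le; apply/walkP; exists (rev (belast v p)); split.
- by rewrite size_rev size_belast.
- rewrite -lp rev_path; apply: sub_path vp => x y xy; by rewrite adj_sym.
- by case: p {sp vp} lp => [/= ->|x p _] //; rewrite /= rev_cons last_rcons.
Qed.

Lemma dist_eq0 (u v : G) : dist u v = 0%N -> u = v.
Proof.
move=> d0; have := dist_walk u v; rewrite d0 => /walkP[p [/size0nil-> _]].
by [].
Qed.

Lemma dist_adj_le (u v : G) : adj u v -> (dist u v <= 1)%N.
Proof.
by move=> uv; apply: walk_dist_le; apply/walkP; exists [:: v]; rewrite /= uv.
Qed.

Lemma dist_step (u r : G) : (0 < dist u r)%N ->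
  exists2 v, adj u v & dist v r = (dist u r).-1.
Proof.
move=> d0; have [[|v p] [sp]] := walkP _ _ _ (dist_walk u r).
  by move: d0; rewrite -sp.
move=> /= /andP[uv vp] lp; exists v => //; apply/eqP; rewrite eqn_leq.
have le : (dist v r <= size p)%N by apply: walk_dist_le; apply/walkP; exists p.
move: sp => /= sp; rewrite -sp /= le /=.
by have := dist_triangle u v r; have := dist_adj_le uv; lia.
Qed.

(** At the root no neighbour qualifies, so the default makes it its own parent, in accord with the
    truncated predecessor. *)
Definition bfs_parent (r u : G) : G :=
  odflt u [pick v | adj u v && (dist v r == (dist u r).-1)].

Lemma dist_bfs_parent (r u : G) : dist (bfs_parent r u) r = (dist u r).-1.
Proof.
rewrite /bfs_parent; case: pickP => [v /andP[_ /eqP]|/= no] //.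
case: (posnP (dist u r)) => [->//|/dist_step[v uv dv]].
by have := no v; rewrite uv dv eqxx.
Qed.

Lemma dist_iter_parent (r u : G) (k : nat) :
  (dist u (iter k (bfs_parent r) u) <= k)%N.
Proof.
elim: k => [|k IH] /=; first by rewrite dist_refl.
set w := iter k _ u in IH *.
apply: leq_trans (dist_triangle u w _) _; rewrite -addn1 leq_add //.
rewrite /bfs_parent; case: pickP => [v /andP[wv _]|_] /=.
  exact: dist_adj_le.
by rewrite dist_refl.
Qed.

Lemma near_dist_le (r u w : G) (k : nat) :
  near (bfs_parent r) u w k -> (dist u w <= k)%N.
Proof.
move=> [a [b [ab e]]]; apply: leq_trans ab.
apply: leq_trans (dist_triangle u (iter a (bfs_parent r) u) w) _.
rewrite leq_add ?dist_iter_parent // e.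
by apply: leq_trans (dist_sym_le _ _) _; apply: dist_iter_parent.
Qed.

(** Index [q * d + t] with [t < d] serves ball number [t] of class [q], and its radius is at least
    [q * d]. The last [m] indices exceed [D * d] and serve [V]. *)
Lemma burning_number_le (D d m : nat) (r : G) (U : seq (G * 'I_D.+1))
    (V : seq G) :
  (0 < d)%N ->
  (forall u, class_covered (bfs_parent r) d U V u) ->
  (forall q, (load U q <= d)%N) -> (size V <= m)%N ->
  (burning_number G <= D.+1 * d + m)%N.
Proof.
move=> d0 cov loadU sizeV; rewrite /burning_number; case: ex_minnP => k _; apply.
pose L q := [seq b.1 | b <- U & b.2 == q].
have sizeL q : size (L q) = load U q by rewrite size_map size_filter.
apply/existsP; exists [ffun i : 'I_(D.+1 * d + m) =>
  if (i < D.+1 * d)%N then nth r (L (inord (i %/ d))) (i %% d)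
  else nth r V (i - D.+1 * d)].
apply/forallP => u; apply/existsP; case: (cov u) => [[b bU nb]|[v vV nv]].
  have bL : b.1 \in L b.2 by apply/mapP; exists b; rewrite // mem_filter eqxx.
  have td : (index b.1 (L b.2) < d)%N.
    by apply: leq_trans (loadU b.2); rewrite -sizeL index_mem.
  set t := index _ _ in td.
  have iD : (b.2 * d + t < D.+1 * d)%N.
    apply: (@leq_trans (b.2.+1 * d)); first by rewrite mulSn addnC ltn_add2r.
    by rewrite leq_mul2r ltn_ord orbT.
  exists (Ordinal (leq_trans iD (leq_addr m _))); rewrite ffunE /= iD.
  rewrite divnMDl // divn_small // addn0 inord_val modnMDl modn_small //.
  by rewrite nth_index // (leq_trans (near_dist_le nb)) ?leq_addr.
have tm : (index v V < m)%N by apply: leq_trans sizeV; rewrite index_mem.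
have iD : (D.+1 * d + index v V < D.+1 * d + m)%N by rewrite ltn_add2l.
exists (Ordinal iD); rewrite ffunE /= ltnNge leq_addr /= addKn nth_index //.
apply: leq_trans (near_dist_le nv) _.
by rewrite (leq_trans _ (leq_addr _ _)) // leq_mul2r leqnSn orbT.
Qed.

(** The bound on the order keeps the allowance of a class within [(1 - eta) d], so an overrun of
    [B = eta d] still fits its [d] indices. A large [Gam] means small parts and so little
    second-order growth. *)
Lemma burning_number_bound (F : realFieldType) (D d M Gam : nat) (eta : F) :
  0 < eta <= 1 -> (0 < D)%N -> (0 < d)%N -> (0 < M)%N ->
  (Gam * M <= #|G| <= (Gam + Gam) * M)%N ->
  #|G|%:R <= (1 - eta) * (D * d)%:R ^+ 2 ->
  4 * D.+1%:R * (D.+1%:R * (4 * D.+1%:R / eta + 1)) ^+ 2 <= Gam%:R * eta ^+ 2 ->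
  (burning_number G <= D.+1 * d + (Gam + Gam).+1)%N.
Proof.
move=> /andP[e0 e1] D0 d0 M0 /andP[GM GM2] cardG GamE.
set Q : F := D.+1%:R in GamE *; set kap := Q * (4 * Q / eta + 1) in GamE.
pose K : F := (D * d)%:R ^+ 2.
have Q0 : 0 < Q by rewrite ltr0n.
have kap1 : 1 <= kap.
  have : 0 <= 4 * Q / eta by rewrite !mulr_ge0 ?invr_ge0 ?ltW.
  have : 1 <= Q by rewrite ler1n.
  by rewrite /kap; nra.
have Gam0 : (0 < Gam)%N.
  rewrite -(ltr0n F) -(pmulr_lgt0 _ (exprn_gt0 2 e0)); apply: lt_le_trans GamE.
  have kap0 : 0 < kap by apply: lt_le_trans kap1.
  by rewrite mulr_gt0 ?exprn_gt0 // mulr_gt0.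
have [r _] : exists r : G, r \in predT.
  by apply/card_gt0P; apply: leq_trans GM; rewrite muln_gt0 Gam0.
have d0F : 0 < d%:R :> F by rewrite ltr0n.
have K0 : 0 < K by rewrite exprn_gt0 // ltr0n muln_gt0 D0.
pose a : F := d%:R / K; pose B := eta * d%:R.
(* This [theta] makes the total first-order growth at most [B ^+ 2 / 2]; the second-order growth
   gets the other half. *)
pose theta := eta ^+ 2 * d%:R / (4 * Q).
have a0 : 0 <= a by rewrite divr_ge0 ?ltW.
have an : a * #|G|%:R <= (1 - eta) * d%:R.
  by rewrite /a mulrAC ler_pdivrMr // mulrAC mulrC ler_wpM2r // ltW.
have theta0 : 0 < theta by rewrite divr_gt0 ?mulr_gt0 ?exprn_gt0.
have kapE : kap * theta = Q * (B + theta).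
  by rewrite /kap /theta /B; field; rewrite nat1r !lt0r_neq0.
have AB : ((theta * a * Q) *+ 2 + (Q * kap ^+ 2 * a ^+ 2 * M%:R) *+ 2) * #|G|%:R
    <= B ^+ 2.
  have an0 : 0 <= a * #|G|%:R by rewrite mulr_ge0.
  have an1 : a * #|G|%:R <= d%:R by apply: le_trans an _; nra.
  have aM0 : 0 <= a * M%:R by rewrite mulr_ge0.
  have aM1 : Gam%:R * (a * M%:R) <= d%:R.
    apply: le_trans an1; rewrite mulrCA -natrM ler_wpM2l // ler_nat //.
  have tQ : theta * Q = eta ^+ 2 * d%:R / 4.
    by rewrite /theta; field; rewrite nat1r lt0r_neq0.
  have lin : (theta * a * Q) * #|G|%:R <= B ^+ 2 / 4.
    have -> : theta * a * Q * #|G|%:R = theta * Q * (a * #|G|%:R) by ring.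
    have -> : B ^+ 2 / 4 = eta ^+ 2 * d%:R / 4 * d%:R by rewrite /B; ring.
    rewrite tQ ler_wpM2l // divr_ge0 // mulr_ge0 ?sqr_ge0 //.
  have quad : 4 * (Q * kap ^+ 2 * a ^+ 2 * M%:R * #|G|%:R) <= B ^+ 2.
    have -> : 4 * (Q * kap ^+ 2 * a ^+ 2 * M%:R * #|G|%:R) =
      4 * Q * kap ^+ 2 * ((a * M%:R) * (a * #|G|%:R)) by ring.
    apply: (@le_trans _ _ (Gam%:R * eta ^+ 2 * ((a * M%:R) * (a * #|G|%:R)))).
      by apply: ler_wpM2r => //; apply: mulr_ge0.
    have -> : Gam%:R * eta ^+ 2 * (a * M%:R * (a * #|G|%:R)) =
      eta ^+ 2 * (Gam%:R * (a * M%:R) * (a * #|G|%:R)) by ring.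
    rewrite /B exprMn ler_wpM2l ?sqr_ge0 // expr2.
    by apply: ler_pM => //; apply: mulr_ge0.
  by rewrite !mulr2n; lra.
have [] := @cover_by_classes G (bfs_parent r) (fun u => dist u r)
  (dist_bfs_parent r) F D d M r a B theta kap D0 d0 (dist_refl r)
  (fun u => @dist_eq0 u r) a0 _ _ theta0 kap1 kapE AB M0.
- by rewrite /a divfK ?lt0r_neq0.
- by rewrite mulr_ge0 // ltW.
move=> U [V [cov loadU sizeV]].
apply: (burning_number_le d0 cov).
  move=> q; rewrite -(ler_nat F); apply: le_trans (loadU q) _.
  by rewrite /B; lra.
rewrite -(leq_pmul2r M0); apply: leq_trans sizeV _.
by rewrite mulSn addnC leq_add2l.
Qed.

End Graph.

(** * Choice of the parameters for a given [eps] *)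

Theorem theorem1p2 (R : realType) (eps : R) (eps_gt0 : 0 < eps) :
  exists N : nat, forall (n : nat) (G : sgraph),
    (N <= n)%N -> #|G| = n -> connected G ->
    (burning_number G)%:R <= (1 + eps) * Num.sqrt (n%:R : R).
Proof.
have lt_trunc (x : R) : x <= (Num.trunc x).+1%:R by rewrite ltW ?truncnS_gt.
(* Capping at 1 gives [eta <= 1/6], so that [(1 - eta) (1 + eta)^2 >= 1] and
   [(1 + eta)^2 <= 1 + e / 2]. *)
pose e := Num.min eps 1; pose eta := e / 6.
have [e0 e1 ee] : [/\ 0 < e, e <= 1 & e <= eps].
  by rewrite lt_min eps_gt0 ltr01 !ge_min !lexx orbT.
have [eta0 eta1] : 0 < eta /\ 6 * eta <= 1.
  by rewrite /eta; split; lra.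
pose D := (Num.trunc (eta^-1)).+1.
have D0 : 0 < D%:R :> R by rewrite ltr0n.
have De : 1 <= D%:R * eta by rewrite -ler_pdivrMr // div1r lt_trunc.
pose Q : R := D.+1%:R; pose X := 4 * Q * (Q * (4 * Q / eta + 1)) ^+ 2.
pose Gam := (Num.trunc (X / eta ^+ 2)).+1.
have GamE : X <= Gam%:R * eta ^+ 2 by rewrite -ler_pdivrMr ?exprn_gt0 ?lt_trunc.
(* [C] collects the terms independent of [n], and [N0] makes it at most [e / 2] times the square
   root of [n]. *)
pose C : R := (D + Gam + Gam + 2)%:R.
pose N0 := (Num.trunc ((2 * C / e) ^+ 2)).+1.
exists (maxn Gam N0) => n G; rewrite geq_max => /andP[nGam nN0] cardG G_conn.
pose s : R := Num.sqrt n%:R.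
have s2 : s ^+ 2 = n%:R by rewrite sqr_sqrtr.
have sC : C <= e / 2 * s.
  have C0 : 0 <= 2 * C / e by rewrite divr_ge0 ?mulr_ge0 ?(ltW e0).
  have le_s : 2 * C / e <= s.
    rewrite -ler_sqr ?nnegrE ?sqrtr_ge0 // s2.
    by apply: le_trans (lt_trunc _) _; rewrite ler_nat.
  by move: le_s; rewrite ler_pdivrMr //; lra.
have s0 : 0 < s by rewrite sqrtr_gt0 ltr0n (leq_trans _ nGam).
(* [D d] is at least [(1 + eta) s] and exceeds it by at most [D]; this gives
   [n <= (1 - eta) (D d)^2]. *)
pose d := (Num.trunc (s * (1 + eta) / D%:R)).+1.
have dle : d%:R <= s * (1 + eta) / D%:R + 1.
  rewrite /d -natr1 lerD2r truncn_le divr_ge0 ?mulr_ge0 ?(ltW s0) ?(ltW D0) //.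
  by rewrite addr_ge0 ?(ltW eta0).
have dge : s * (1 + eta) <= D%:R * d%:R.
  by rewrite [leRHS]mulrC -ler_pdivrMr // lt_trunc.
have Ddle : D%:R * d%:R <= s * (1 + eta) + D%:R.
  have -> : s * (1 + eta) + D%:R = D%:R * (s * (1 + eta) / D%:R + 1).
    by field; rewrite lt0r_neq0.
  by rewrite ler_pM2l.
have dle2 : d%:R <= s * (1 + eta) * eta + 1.
  apply: le_trans dle _; rewrite lerD2r ler_pdivrMr // -[leRHS]mulrA.
  rewrite ler_peMr ?mulr_ge0 ?(ltW s0) ?addr_ge0 ?(ltW eta0) //.
  by rewrite mulrC.
have M0 : (0 < n %/ Gam)%N by rewrite divn_gt0.
have bound := @burning_number_bound G G_conn R D d (n %/ Gam) Gam eta.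
have : (burning_number G <= D.+1 * d + (Gam + Gam).+1)%N.
  apply: bound => //; rewrite ?cardG.
  - by rewrite eta0; lra.
  - have := divn_eq n Gam; have := ltn_pmod n (ltn0Sn _ : (0 < Gam)%N).
    by move: (n %/ Gam)%N (n %% Gam)%N M0 => m l; clear; nia.
  rewrite -s2 natrM.
  have e2 : 1 <= (1 - eta) * (1 + eta) ^+ 2 by nra.
  have : (s * (1 + eta)) ^+ 2 <= (D%:R * d%:R) ^+ 2.
    by rewrite ler_sqr ?nnegrE ?mulr_ge0 ?(ltW s0) ?addr_ge0 ?(ltW eta0).
  by have := sqr_ge0 s; nra.
rewrite -(ler_nat R) => /le_trans; apply.
have -> : (D.+1 * d + (Gam + Gam).+1)%:R = D%:R * d%:R + d%:R + (Gam + Gam + 1)%:R :> R.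
  by rewrite addn1 natrD natrM -natr1 mulrDl mul1r.
have CE : C = D%:R + (Gam + Gam + 1)%:R + 1.
  by rewrite /C !natrD; ring.
(* The bounds on [D d] and [d] add up to [s (1 + eta)^2 + C], at most [s (1 + e / 2) + s e / 2]. *)
have sq : s * (1 + eta) ^+ 2 <= s * (1 + e / 2).
  by rewrite ler_pM2l // /eta; nra.
have se : s * e <= s * eps by rewrite ler_pM2l.
move: sC; rewrite -/s CE; clearbody s D d Gam eta e; lra.
Qed.
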